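(* Let $\overline{A_0A_1A_2A_3}$ be a tetrahedron in $\mathbb{A}^3$ with $B$-quadreas $\mathcal{A}_{012},\mathcal{A}_{013},\mathcal{A}_{023},\mathcal{A}_{123}$ (all nonzero), $B$-quadrume $\mathcal{V}$ and $B$-dual solid spreads $\mathcal{D}_0,\mathcal{D}_1,\mathcal{D}_2,\mathcal{D}_3$, and let $$\mathcal{R}\equiv\frac{16\mathcal{V}^2}{\mathcal{A}_{012}\mathcal{A}_{013}\mathcal{A}_{023}\mathcal{A}_{123}}.$$ Then $$\frac{\mathcal{D}_0}{\mathcal{A}_{123}}=\frac{\mathcal{D}_1}{\mathcal{A}_{023}}=\frac{\mathcal{D}_2}{\mathcal{A}_{013}}=\frac{\mathcal{D}_3}{\mathcal{A}_{012}}=\frac{\mathcal{R}}{4}.$$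
   Context: Let $\mathbb{F}$ be a field of characteristic not $2$, $\mathbb{V}^3=\mathbb{F}^3$ the space of row vectors, and $\mathbb{A}^3$ the three-dimensional affine space over $\mathbb{F}$ with associated vector space $\mathbb{V}^3$; $\overrightarrow{XY}=Y-X$ for points $X,Y$. Let $B$ be a symmetric invertible $3\times3$ matrix over $\mathbb{F}$. Define $v\cdot_B w=vBw^T$, $Q_B(v)=v\cdot_B v$, $v\times_B w=(v\times w)\,\mathrm{adj}\,B$ where $\times$ is the usual cross product and $\mathrm{adj}\,B=(\det B)B^{-1}$, and $[v_1,v_2,v_3]_B=v_1\cdot_B(v_2\times_B v_3)$. A tetrahedron $\overline{A_0A_1A_2A_3}$ is a collection of four points of $\mathbb{A}^3$. Put $Q_{ij}=Q_B(\overrightarrow{A_iA_j})$ (symmetric in $i,j$). The $B$-quadreas are $\mathcal{A}_{ijk}=A(Q_{ij},Q_{ik},Q_{jk})$ with $A(a,b,c)=(a+b+c)^2-2(a^2+b^2+c^2)$. The $B$-quadrume is $\mathcal{V}=\frac{4}{\det B}[\overrightarrow{A_0A_1},\overrightarrow{A_0A_2},\overrightarrow{A_0A_3}]_B^2$. The $B$-solid spread of three concurrent lines with non-null direction vectors $u_1,u_2,u_3$ is $\frac{([u_1,u_2,u_3]_B)^2}{(\det B)Q_B(u_1)Q_B(u_2)Q_B(u_3)}$. The $B$-dual solid spread of three concurrent lines with direction vectors $v_1,v_2,v_3$ is the $B$-solid spread of the three lines through the same point with direction vectors $v_1\times_B v_2$, $v_1\times_B v_3$, $v_2\times_B v_3$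 (assumed non-null). For $\{i,j,k,l\}=\{0,1,2,3\}$, $\mathcal{D}_i$ is the $B$-dual solid spread of the lines $A_iA_j$, $A_iA_k$, $A_iA_l$. When all four $B$-quadreas are nonzero, all $\mathcal{D}_i$ are defined. *)

(* Defs.v *)
From mathcomp Require Export all_boot all_order all_algebra.

Set Implicit Arguments.
Unset Strict Implicit.
Unset Printing Implicit Defensive.

Export GRing.Theory.
Global Open Scope ring_scope.

(* Both the vectors of V^3 and, in affine coordinates, the points of A^3 are
   row vectors 'rV[F]_3; the vector from X to Y is Y - X. *)

Definition dotB (F : fieldType) (B : 'M[F]_3) (v w : 'rV[F]_3) : F :=
  (v *m B *m w^T) 0 0.

Definition quadB (F : fieldType) (B : 'M[F]_3) (v : 'rV[F]_3) : F := dotB B v v.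

(* The column indices are elements of the ring 'I_3, so j + 1 and j + 2 are
   taken modulo 3; for j = 0, 1, 2 this gives the three usual coordinates. *)
Definition cross (F : fieldType) (v w : 'rV[F]_3) : 'rV[F]_3 :=
  \row_(j < 3) (v 0 (j + 1) * w 0 (j + 2) - v 0 (j + 2) * w 0 (j + 1)).

Definition crossB (F : fieldType) (B : 'M[F]_3) (v w : 'rV[F]_3) : 'rV[F]_3 :=
  cross v w *m \adj B.

Definition tripleB (F : fieldType) (B : 'M[F]_3) (v1 v2 v3 : 'rV[F]_3) : F :=
  dotB B v1 (crossB B v2 v3).

Definition archimedes (F : fieldType) (a b c : F) : F :=
  (a + b + c) ^+ 2 - 2 * (a ^+ 2 + b ^+ 2 + c ^+ 2).

(* Three concurrent lines are given by direction vectors. The value is the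
   solid spread only when these are non-null; otherwise it is the junk value 0
   of division by zero. *)
Definition solid_spread (F : fieldType) (B : 'M[F]_3) (u1 u2 u3 : 'rV[F]_3) : F :=
  tripleB B u1 u2 u3 ^+ 2 / (\det B * quadB B u1 * quadB B u2 * quadB B u3).

Definition dual_solid_spread (F : fieldType) (B : 'M[F]_3)
    (v1 v2 v3 : 'rV[F]_3) : F :=
  solid_spread B (crossB B v1 v2) (crossB B v1 v3) (crossB B v2 v3).

(* A tetrahedron is any family A : 'I_4 -> 'rV[F]_3 of four points. *)

Definition quadrance (F : fieldType) (B : 'M[F]_3) (A : 'I_4 -> 'rV[F]_3)
    (i j : 'I_4) : F :=
  quadB B (A j - A i).

Definition quadrea (F : fieldType) (B : 'M[F]_3) (A : 'I_4 -> 'rV[F]_3)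
    (i j k : 'I_4) : F :=
  archimedes (quadrance B A i j) (quadrance B A i k) (quadrance B A j k).

Definition quadrume (F : fieldType) (B : 'M[F]_3) (A : 'I_4 -> 'rV[F]_3) : F :=
  4 / \det B * tripleB B (A 1 - A 0) (A 2 - A 0) (A 3 - A 0) ^+ 2.

(* lift i 0, lift i 1, lift i 2 are the three indices other than i, in
   increasing order; the dual solid spread does not depend on that order. *)
Definition vertex_dual_spread (F : fieldType) (B : 'M[F]_3)
    (A : 'I_4 -> 'rV[F]_3) (i : 'I_4) : F :=
  dual_solid_spread B (A (lift i (0 : 'I_3)) - A i)
    (A (lift i (1 : 'I_3)) - A i) (A (lift i (2 : 'I_3)) - A i).

(* Main.v *)
Require Import Defs.
From mathcomp Require Import all_boot all_order all_algebra.
From mathcomp Require Import ring.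

Set Implicit Arguments.
Unset Strict Implicit.
Unset Printing Implicit Defensive.

(** Every quantity in the theorem is an expression in three kinds of scalars: [\det B],
    the volume [box u v w] spanned by the edge vectors, and the Gram
    determinants [gram B v w] of the faces.

    - The triple product is [\det B * box] ([tripleBE]), so the quadrume is
      [4 * \det B * box ^+ 2].
    - The quadrea of a triangle is four times the Gram determinant of any two
      of its sides ([quadreaE]), which is Heron's formula.
    - By the Lagrange identity for [B], the quadrance of [crossB B v w] is
      [\det B * gram B v w] ([quadB_crossB]).
    - The three cross products of [u], [v], [w] span the volume [box ^+ 2]
      ([box_cross]), so their triple product relative to [B] is
      [\det B ^+ 3 * box ^+ 2] ([tripleB_crossB]).

    Hence the dual solid spread at a vertex is
    [\det B ^+ 2 * box ^+ 4 / (gram * gram * gram)], with one Gram determinant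
    for each face through that vertex. Dividing by the quadrea of the opposite
    face completes the denominator to the product of all four quadreas, and the
    numerator [box ^+ 4] does not depend on the vertex from which the edge
    vectors are drawn ([box_edges_sqr]). So the four ratios have a common
    value, which is four times the squared quadrume over the product of
    the quadreas ([dual_spread_ratio]). *)

Section Volume.
Variable F : fieldType.
Implicit Types (u v w x y : 'rV[F]_3) (M : 'M[F]_3).

(** * The volume spanned by three vectors *)

Definition frame u v w : 'M[F]_3 := \matrix_(i < 3) [:: u; v; w]`_i.

Definition box u v w : F := \det (frame u v w).

Lemma sum_I3 (f : 'I_3 -> F) : \sum_(j < 3) f j = f 0 + f 1 + f 2.
Proof.
rewrite !big_ord_recl big_ord0 addr0 addrA.
by congr (f _ + f _ + f _); apply: val_inj.
Qed.

Lemma row_dotE v w : (v *m w^T) 0 0 = v 0 0 * w 0 0 + v 0 1 * w 0 1 + v 0 2 * w 0 2.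
Proof. by rewrite mxE sum_I3 !mxE. Qed.

Lemma crossE v w :
  (cross v w 0 0 = v 0 1 * w 0 2 - v 0 2 * w 0 1)
  * (cross v w 0 1 = v 0 2 * w 0 0 - v 0 0 * w 0 2)
  * (cross v w 0 2 = v 0 0 * w 0 1 - v 0 1 * w 0 0).
Proof.
by do ![split]; rewrite mxE; congr (v 0 _ * w 0 _ - v 0 _ * w 0 _); apply: val_inj.
Qed.

Lemma det_mx3 M : \det M =
    M 0 0 * (M 1 1 * M 2 2 - M 1 2 * M 2 1)
  + M 0 1 * (M 1 2 * M 2 0 - M 1 0 * M 2 2)
  + M 0 2 * (M 1 0 * M 2 1 - M 1 1 * M 2 0).
Proof.
rewrite (expand_det_row M 0) sum_I3 /cofactor.
rewrite !(expand_det_row _ 0) !big_ord_recl !big_ord0 /cofactor !det_mx11 !mxE /=.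
(* Entries indexed by natural numbers make the ordinals compute. *)
have [m mE] : exists m : nat -> nat -> F, forall i j : 'I_3, M i j = m i j.
  by exists (fun i j => M (inord i) (inord j)) => i j; rewrite !inord_val.
rewrite !mE /= /bump /=.
ring.
Qed.

Lemma boxE u v w : box u v w = (u *m (cross v w)^T) 0 0.
Proof. by rewrite /box det_mx3 row_dotE !crossE !mxE. Qed.

Lemma frame_mul u v w M : frame u v w *m M = frame (u *m M) (v *m M) (w *m M).
Proof.
apply/row_matrixP => i; rewrite row_mul !rowK.
by case: i => [[|[|[|]]]].
Qed.

Lemma box_mul u v w M : box (u *m M) (v *m M) (w *m M) = box u v w * \det M.
Proof. by rewrite /box -frame_mul det_mulmx. Qed.

Lemma row_dot_inj v w : (forall u, (u *m v^T) 0 0 = (u *m w^T) 0 0) -> v = w.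
Proof.
move=> h; apply/rowP => j; have := h (delta_mx 0 j).
by rewrite -!rowE !mxE.
Qed.

(** The vector [cross v w] represents the linear form [box _ v w], and a linear
    map scales volumes by its determinant; so the cross product transforms
    contravariantly, by the transpose of the adjugate. Invertibility of [M]
    makes every test vector of the form [u *m M]. *)
Lemma cross_mul v w M : M \in unitmx ->
  cross (v *m M) (w *m M) = cross v w *m (\adj M)^T.
Proof.
move=> uM; apply: row_dot_inj => u.
rewrite -(mulmxKV uM u); set t := u *m invmx M.
rewrite -boxE box_mul boxE trmx_mul trmxK mulmxA -(mulmxA t) mul_mx_adj.
by rewrite mul_mx_scalar -scalemxAl [RHS]mxE mulrC.
Qed.

Lemma cross_Lagrange v w x y : (cross v w *m (cross x y)^T) 0 0 =
  (v *m x^T) 0 0 * (w *m y^T) 0 0 - (v *m y^T) 0 0 * (w *m x^T) 0 0.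
Proof. by rewrite !row_dotE !crossE; ring. Qed.

(** Up to order and sign, the three cross products are the columns of the
    adjugate of [frame u v w], whose determinant is the square of [box u v w].
    In this arrangement one transposition compensates the one sign change, from
    [cross w u] to [cross u w]. *)
Lemma box_cross u v w :
  box (cross u v) (cross u w) (cross v w) = box u v w ^+ 2.
Proof. by rewrite !boxE !row_dotE !crossE; ring. Qed.

(** Moving the base point of the edge vectors to another vertex, and reordering
    the vertices, changes the volume at most by a sign. *)
Lemma box_edges_sqr (P X Y Z : 'rV[F]_3) :
  (box (P - X) (Y - X) (Z - X) ^+ 2 = box (X - P) (Y - P) (Z - P) ^+ 2)
  * (box (P - Y) (X - Y) (Z - Y) ^+ 2 = box (X - P) (Y - P) (Z - P) ^+ 2)
  * (box (P - Z) (X - Z) (Y - Z) ^+ 2 = box (X - P) (Y - P) (Z - P) ^+ 2).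
Proof. by do ![split]; rewrite !boxE !row_dotE !crossE !mxE; ring. Qed.

End Volume.

Section SymmetricForm.
Variables (F : fieldType) (B : 'M[F]_3).
Hypothesis symB : B^T = B.
Implicit Types (u v w : 'rV[F]_3).

(** * Gram determinants and Heron's formula *)

Definition gram v w : F := quadB B v * quadB B w - dotB B v w ^+ 2.

Lemma dotBC v w : dotB B v w = dotB B w v.
Proof.
rewrite /dotB -[LHS](mxE trmx_key (fun i j => (v *m B *m w^T) j i)).
by rewrite -/(trmx _) !trmx_mul trmxK symB mulmxA.
Qed.

Lemma quadB_sub v w : quadB B (v - w) = quadB B v + quadB B w - 2 * dotB B v w.
Proof.
have sub_l x y z : dotB B (x - y) z = dotB B x z - dotB B y z.
  by rewrite /dotB !mulmxBl !mxE.
rewrite /quadB sub_l ![dotB B _ (v - w)]dotBC !sub_l (dotBC w v).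
ring.
Qed.

Lemma quadB_subC v w : quadB B (v - w) = quadB B (w - v).
Proof. by rewrite !quadB_sub dotBC; ring. Qed.

Lemma archimedes_gram v w :
  archimedes (quadB B v) (quadB B w) (quadB B (w - v)) = 4 * gram v w.
Proof. by rewrite quadB_sub /archimedes /gram (dotBC w v); ring. Qed.

Lemma quadreaE (A : 'I_4 -> 'rV[F]_3) i j k :
  quadrea B A i j k = 4 * gram (A j - A i) (A k - A i).
Proof.
rewrite -archimedes_gram /quadrea /quadrance.
by rewrite (_ : A k - A i - (A j - A i) = A k - A j) // opprB addrA subrK.
Qed.

Lemma quadreaC (A : 'I_4 -> 'rV[F]_3) i j k :
  quadrea B A i j k = quadrea B A j i k.
Proof.
by rewrite /quadrea /quadrance /archimedes (quadB_subC (A i)); ring.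
Qed.

Lemma quadreaCr (A : 'I_4 -> 'rV[F]_3) i j k :
  quadrea B A i j k = quadrea B A i k j.
Proof.
by rewrite /quadrea /quadrance /archimedes (quadB_subC (A k) (A j)); ring.
Qed.

(** * Products of vectors relative to the form *)

Lemma tripleBE u v w : tripleB B u v w = \det B * box u v w.
Proof.
rewrite /tripleB /dotB /crossB trmx_mul trmx_adj symB mulmxA -(mulmxA u).
by rewrite mul_mx_adj mul_mx_scalar -scalemxAl mxE boxE.
Qed.

Hypothesis invB : B \in unitmx.

(** The two copies of [\adj B] in the quadrance surround [B], leaving
    [\det B] times the form [\adj B] at the Euclidean cross product. The latter
    value is a product of two Euclidean cross products, by [cross_mul], and the
    Euclidean Lagrange identity turns it into the Gram determinant. *)
Lemma quadB_crossB v w : quadB B (crossB B v w) = \det B * gram v w.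
Proof.
have adjT : (\adj B)^T = \adj B by rewrite trmx_adj symB.
rewrite /quadB /dotB /crossB trmx_mul adjT -(mulmxA _ (\adj B)) mul_adj_mx.
rewrite mul_mx_scalar -scalemxAl mxE; congr (_ * _).
rewrite mulmxA -{1}adjT -cross_mul // cross_Lagrange.
by rewrite /gram /quadB expr2 {2}dotBC.
Qed.

Lemma tripleB_crossB u v w :
  tripleB B (crossB B u v) (crossB B u w) (crossB B v w)
  = \det B ^+ 3 * box u v w ^+ 2.
Proof.
have det_adj : \det (\adj B) = \det B ^+ 2.
  have detB0 : \det B != 0 by rewrite -unitfE -unitmxE.
  apply: (mulfI detB0).
  by rewrite -det_mulmx mul_mx_adj det_scalar -exprS.
by rewrite tripleBE /crossB box_mul box_cross det_adj; ring.
Qed.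

Lemma dual_solid_spreadE u v w : dual_solid_spread B u v w =
  \det B ^+ 2 * box u v w ^+ 4 / (gram u v * gram u w * gram v w).
Proof.
have detB0 : \det B != 0 by rewrite -unitfE -unitmxE.
rewrite /dual_solid_spread /solid_spread tripleB_crossB !quadB_crossB.
(* Only \det B can be cancelled; the Gram determinants may vanish here. *)
set g := gram u v * gram u w * gram v w.
have -> : \det B * (\det B * gram u v) * (\det B * gram u w)
          * (\det B * gram v w) = \det B ^+ 4 * g by rewrite /g; ring.
by rewrite invfM; move: (g^-1) => h; field.
Qed.

(** The denominator is symmetric in the four faces, and the numerator depends on
    the vertex [A i] only through the square of [box], hence not at all. *)
Lemma dual_spread_ratio (A : 'I_4 -> 'rV[F]_3) (i j k l : 'I_4) :
    quadrea B A i j k != 0 -> quadrea B A i j l != 0 ->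
    quadrea B A i k l != 0 -> quadrea B A j k l != 0 ->
  dual_solid_spread B (A j - A i) (A k - A i) (A l - A i) / quadrea B A j k l
  = 64 * \det B ^+ 2 * (box (A j - A i) (A k - A i) (A l - A i) ^+ 2) ^+ 2
    / (quadrea B A i j k * quadrea B A i j l * quadrea B A i k l
       * quadrea B A j k l).
Proof.
rewrite dual_solid_spreadE (quadreaE A i j k) (quadreaE A i j l) (quadreaE A i k l).
rewrite !mulf_eq0 !negb_or => /andP[n4 g1] /andP[_ g2] /andP[_ g3] q.
by field; rewrite n4 g1 g2 g3 q.
Qed.

End SymmetricForm.

(** * The common ratio *)

Theorem theorem23 (F : fieldType) (charF : 2%N \notin [pchar F])
    (B : 'M[F]_3) (symB : B^T = B) (invB : B \in unitmx)
    (A : 'I_4 -> 'rV[F]_3)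
    (nz012 : quadrea B A 0 1 2 != 0) (nz013 : quadrea B A 0 1 3 != 0)
    (nz023 : quadrea B A 0 2 3 != 0) (nz123 : quadrea B A 1 2 3 != 0) :
  let R := 16 * quadrume B A ^+ 2 /
    (quadrea B A 0 1 2 * quadrea B A 0 1 3 * quadrea B A 0 2 3
       * quadrea B A 1 2 3) in
  [/\ vertex_dual_spread B A 0 / quadrea B A 1 2 3
        = vertex_dual_spread B A 1 / quadrea B A 0 2 3,
      vertex_dual_spread B A 1 / quadrea B A 0 2 3
        = vertex_dual_spread B A 2 / quadrea B A 0 1 3,
      vertex_dual_spread B A 2 / quadrea B A 0 1 3
        = vertex_dual_spread B A 3 / quadrea B A 0 1 2
    & vertex_dual_spread B A 3 / quadrea B A 0 1 2 = R / 4].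
Proof.
move=> R.
have detB0 : \det B != 0 by rewrite -unitfE -unitmxE.
(* 4 is a factor of every quadrea, hence nonzero. *)
have n4 : (4 : F) != 0.
  by move: nz012; rewrite quadreaE // mulf_eq0 negb_or => /andP[].
have RE : R / 4 = 64 * \det B ^+ 2
    * (box (A 1 - A 0) (A 2 - A 0) (A 3 - A 0) ^+ 2) ^+ 2
    / (quadrea B A 0 1 2 * quadrea B A 0 1 3 * quadrea B A 0 2 3
       * quadrea B A 1 2 3).
  rewrite /R /quadrume tripleBE //; field.
  by rewrite detB0 n4 nz012 nz013 nz023 nz123.
have spreadE (i a b c : 'I_4) : lift i (0 : 'I_3) = a -> lift i (1 : 'I_3) = b ->
    lift i (2 : 'I_3) = c ->
    vertex_dual_spread B A i
    = dual_solid_spread B (A a - A i) (A b - A i) (A c - A i).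
  by rewrite /vertex_dual_spread => -> -> ->.
have D0 : vertex_dual_spread B A 0 / quadrea B A 1 2 3 = R / 4.
  rewrite (spreadE 0 1 2 3); do ?exact: val_inj.
  by rewrite dual_spread_ratio.
have D1 : vertex_dual_spread B A 1 / quadrea B A 0 2 3 = R / 4.
  rewrite (spreadE 1 0 2 3); do ?exact: val_inj.
  have q102 := quadreaC symB A 1 0 2; have q103 := quadreaC symB A 1 0 3.
  rewrite dual_spread_ratio ?q102 ?q103 // RE (box_edges_sqr _ (A 1) (A 2)).
  by congr (_ / _); ring.
have D2 : vertex_dual_spread B A 2 / quadrea B A 0 1 3 = R / 4.
  rewrite (spreadE 2 0 1 3); do ?exact: val_inj.
  have q201 : quadrea B A 2 0 1 = quadrea B A 0 1 2.
    by rewrite quadreaC // quadreaCr.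
  have q203 := quadreaC symB A 2 0 3; have q213 := quadreaC symB A 2 1 3.
  rewrite dual_spread_ratio ?q201 ?q203 ?q213 // RE (box_edges_sqr _ (A 1) (A 2)).
  by congr (_ / _); ring.
have D3 : vertex_dual_spread B A 3 / quadrea B A 0 1 2 = R / 4.
  rewrite (spreadE 3 0 1 2); do ?exact: val_inj.
  have q3 i j : quadrea B A 3 i j = quadrea B A i j 3.
    by rewrite quadreaC // quadreaCr.
  rewrite dual_spread_ratio ?q3 // RE (box_edges_sqr _ (A 1) (A 2)).
  by congr (_ / _); ring.
by rewrite D0 D1 D2 D3.
Qed.
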